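(* The set $\mathcal{AN}_{\operatorname{non}(\mathcal N)}$ is $2^{\operatorname{non}(\mathcal N)}$-algebrable in $\left(\mathbb R^{\mathbb R}\right)^{\operatorname{non}(\mathcal N)}$ (in ZFC).
   Context: For an infinite cardinal $\kappa$, a $\kappa$-sequence $(x_\alpha)_{\alpha<\kappa}$ converges to $x$ if for every neighbourhood $U$ of $x$ there is $\alpha_0<\kappa$ with $x_\alpha\in U$ for all $\alpha_0<\alpha<\kappa$; $\left(\mathbb R^{\mathbb R}\right)^{\kappa}$ is the commutative real algebra of $\kappa$-sequences of functions $\mathbb R\to\mathbb R$ with indexwise operations. $\operatorname{non}(\mathcal N)$ is the least cardinality of a subset of $[0,1]$ that is not Lebesgue null. $\mathcal{AN}_{\kappa}$: $\kappa$-sequences of Lebesgue measurable functions $f_\alpha:\mathbb R\to\mathbb R$ converging pointwise a.e. to a function that is not Lebesgue measurable. A subset $S$ of an algebra is $\mu$-algebrable if there is a subalgebra $B$ with $B\setminus\{0\}\subset S$, of vector-space dimension $\mu$, having a minimal system of generators $G$ with $\operatorname{card}(G)=\mu$ (minimal: $G$ generates $B$ and no $s\in G$ belongs to the algebra generated by $G\setminus\{s\}$). *)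

(* Defs.v *)
From HB Require Import structures.
From mathcomp Require Import all_boot all_order all_algebra.
From mathcomp Require Import all_classical all_reals all_analysis measurable_realfun.
Set Implicit Arguments. Unset Strict Implicit. Unset Printing Implicit Defensive.
Import Order.TTheory GRing.Theory Num.Theory.
Import numFieldNormedType.Exports.
Local Open Scope classical_set_scope.
Local Open Scope ring_scope.

Section Defs.
Variable R : realType.

Definition leb_null (A : set R) : Prop :=
  (@lebesgue_measure R).-negligible (A : set (measurableTypeR R)).

(** Lebesgue measurable sets: the completion of the Borel sigma-algebra
    w.r.t. Lebesgue measure (Borel set union a null set). *)
Definition leb_measurable_set (A : set R) : Prop :=
  completed_algebra_gen (@lebesgue_measure R) A.

Definition leb_measurable_fun (f : R -> R) : Prop :=
  forall B : set (measurableTypeR R), measurable B ->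
    leb_measurable_set (f @^-1` B).

Definition card_is_nonN (K : Type) : Prop :=
  (exists A : set R, A `<=` [set x | 0 <= x <= 1] /\
      (A #= [set: K])%card /\ ~ leb_null A) /\
  (forall A : set R, A `<=` [set x | 0 <= x <= 1] ->
      ~ ([set: K] #<= A)%card -> leb_null A).
End Defs.

(** [lt] is a strict well-order on K whose order type is an initial ordinal,
    i.e. (K, lt) is (order-isomorphic to) the cardinal |K| seen as an ordinal. *)
Definition initial_ordinal (K : Type) (lt : K -> K -> Prop) : Prop :=
  (forall a, ~ lt a a) /\
  (forall a b c, lt a b -> lt b c -> lt a c) /\
  (forall a b, lt a b \/ a = b \/ lt b a) /\
  well_founded lt /\
  (forall a, ~ ([set: K] #<= [set b | lt b a])%card).

Section Seqs.
Variables (R : realType) (K : Type) (lt : K -> K -> Prop).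

Definition kseq_cvg (u : K -> R) (x : R) : Prop :=
  forall U : set R, nbhs x U ->
    exists a0 : K, forall a, lt a0 a -> U (u a).

Definition AN (F : K -> R -> R) : Prop :=
  (forall a, leb_measurable_fun (F a)) /\
  exists g : R -> R, ~ leb_measurable_fun g /\
    leb_null [set t | ~ kseq_cvg (fun a => F a t) (g t)].

(** Algebra operations in (R^R)^K are indexwise and pointwise. *)
Definition zero_seq : K -> R -> R := fun _ _ => 0.

Definition span (E : set (K -> R -> R)) : set (K -> R -> R) :=
  [set h | exists n (e : 'I_n -> K -> R -> R) (c : 'I_n -> R),
      (forall i, E (e i)) /\ h = (fun a t => \sum_(i < n) c i * e i a t)].

Definition lin_indep (E : set (K -> R -> R)) : Prop :=
  forall n (e : 'I_n -> K -> R -> R) (c : 'I_n -> R),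
    injective e -> (forall i, E (e i)) ->
    (fun a t => \sum_(i < n) c i * e i a t) = zero_seq ->
    forall i, c i = 0.

Definition monomials (G : set (K -> R -> R)) : set (K -> R -> R) :=
  [set h | exists n (m : 'I_n.+1 -> K -> R -> R),
      (forall i, G (m i)) /\ h = (fun a t => \prod_(i < n.+1) m i a t)].

(** The (non-unital) subalgebra generated by G. *)
Definition gen_alg (G : set (K -> R -> R)) : set (K -> R -> R) :=
  span (monomials G).

Definition has_dim (B : set (K -> R -> R)) (I : Type) : Prop :=
  exists E, E `<=` B /\ lin_indep E /\ span E = B /\ (E #= [set: I])%card.

Definition algebrable (S : set (K -> R -> R)) (I : Type) : Prop :=
  exists B G : set (K -> R -> R),
    B = gen_alg G /\
    (forall h, B h -> h <> zero_seq -> S h) /\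
    has_dim B I /\
    (forall s, G s -> ~ gen_alg (G `\ s) s) /\
    (G #= [set: I])%card.
End Seqs.

(* Main.v *)
Require Import Defs.
From mathcomp Require Import all_boot all_order all_algebra.
From mathcomp Require Import all_classical all_reals all_analysis.
From mathcomp Require Import measurable_realfun lra.
Set Implicit Arguments. Unset Strict Implicit. Unset Printing Implicit Defensive.
Import Order.TTheory GRing.Theory Num.Theory.
Import numFieldNormedType.Exports.
Local Open Scope classical_set_scope.
Local Open Scope card_scope.

(** Let κ = non(N).  In [0, 1] there are κ pairwise disjoint non-null sets whose
    union X has cardinality κ and no measurable non-null subset: if κ = 2^ℵ0, a
    Bernstein construction over the closed sets of positive measure; if
    κ < 2^ℵ0, multiples x_k A of a non-null set A, the ratios x_j / x_k avoiding
    the quotients of A, in which case X is too small to contain a closed set of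
    positive measure.  Labelling the pieces by a set I of size κ, a function u
    on I gives the function on X equal to u(i) on the i-th piece, 0 elsewhere;
    it is non-measurable unless u = 0, and it is the limit of its restrictions
    to the initial segments of X, which are null.  As u varies this is an
    injective algebra morphism, so it remains to find 2^κ algebraically
    independent functions on some I of size κ: for S a subset of κ,
    send (F, D, x), with F a finite sequence in κ, to x ^ (D ^ code(S ∩ F)). *)

(** * Cardinal arithmetic by explicit injections *)

Lemma card_le_inj T U (A : set T) (B : set U) (f : T -> U) :
  (forall x, A x -> B (f x)) ->
  (forall x y, A x -> A y -> f x = f y -> x = y) -> A #<= B.
Proof.
move=> fAB finj.
have /injfunPex[g] : exists2 f : T -> U, set_fun A B f & set_inj A f.
  by exists f => // x y /set_mem Ax /set_mem Ay; exact: finj.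
exact: inj_card_le g.
Qed.

Lemma inj_of_card_le T U (u : U) (A : set T) (B : set U) : A #<= B ->
  exists2 f : T -> U, forall x, A x -> B (f x) &
    forall x y, A x -> A y -> f x = f y -> x = y.
Proof.
move=> /card_leP[f].
pose g x := if pselect (A x) is left Ax then set_val (f (SigSub (mem_set Ax))) else u.
have gE x (Ax : A x) : g x = set_val (f (SigSub (mem_set Ax))).
  rewrite /g; case: pselect => // Ax'; congr (set_val (f _)); exact: val_inj.
exists g => [x Ax|x y Ax Ay].
  by rewrite (gE _ Ax); exact: set_valP.
rewrite (gE _ Ax) (gE _ Ay) => /val_inj/(@inj _ _ _ f) => e.
by have := congr1 val (e (mem_set I) (mem_set I)).
Qed.

Lemma card_leT_inj T U (f : T -> U) : injective f -> [set: T] #<= [set: U].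
Proof. by move=> finj; apply: (card_le_inj (f := f)) => // x y _ _ /finj. Qed.

Lemma inj_of_card_leT T U (u : U) : [set: T] #<= [set: U] ->
  exists f : T -> U, injective f.
Proof. by move=> /(inj_of_card_le u)[f _ finj]; exists f => x y; exact: finj. Qed.

(** Zorn's lemma gives a maximal graph [G] of a partial injection from [A] to [B]. If some [a] in
    [A] is outside its domain, then its range is all of [B], since otherwise a pair could be
    added. *)
Lemma card_le_total T U (A : set T) (B : set U) : A #<= B \/ B #<= A.
Proof.
pose P (G : set (T * U)) := (forall p, G p -> A p.1 /\ B p.2) /\
  (forall p q, G p -> G q -> (p.1 = q.1 <-> p.2 = q.2)).
have [F FP Ftot|G [[GAB Ginj] Gmax]] := @Zorn_bigcup (T * U) P.
  split=> [p [X /FP[+ _] Xp]|p q [X FX Xp] [Y FY Yq]]; first exact.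
  have [XY|YX] := Ftot _ _ FX FY.
    by apply: (FP _ FY).2 => //; exact: XY.
  by apply: (FP _ FX).2 => //; exact: YX.
have [domG|ndom] := pselect (forall x, A x -> exists y, G (x, y)).
  left; have [[u _]|B0] := pselect (exists u : U, True); last first.
    have -> : A = set0 by apply/seteqP; split=> // x /domG[y]; case: B0; exists y.
    exact: card_ge0.
  have /choice[f fG] : forall x, exists y, A x -> G (x, y).
    by move=> x; have [/domG[y]|nA] := pselect (A x); [exists y|exists u].
  apply: (card_le_inj (f := f)) => [x /fG/GAB[]//|x y /fG Gx /fG Gy e].
  by apply/(Ginj _ _ Gx Gy).
right; have [a [Aa aG]] : exists a, A a /\ forall y, ~ G (a, y).
  apply: contrapT => h; apply: ndom => x Ax; apply: contrapT => h'; apply: h.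
  by exists x; split=> // y Gy; apply: h'; exists y.
have ranG y : B y -> exists x, G (x, y).
  move=> By; apply: contrapT => h.
  apply: (Gmax (G `|` [set (a, y)])).
    split; first by move=> ? ?; left.
    by move=> /(_ (a, y)) /(_ (or_intror erefl)) /aG.
  split=> [p [/GAB//|->//]|p q [Gp|->] [Gq|->]]; [exact: Ginj| | |by []].
    split=> [e|e]; first by case: (aG p.2); rewrite -[a]e -surjective_pairing.
    by case: h; exists p.1; rewrite -[y]e -surjective_pairing.
  split=> [e|e]; first by case: (aG q.2); rewrite [a]e -surjective_pairing.
  by case: h; exists q.1; rewrite [y]e -surjective_pairing.
have /choice[f fG] : forall y, exists x, B y -> G (x, y).
  by move=> y; have [/ranG[x]|nB] := pselect (B y); [exists x|exists a].
apply: (card_le_inj (f := f)) => [x /fG/GAB[]//|x y /fG Gx /fG Gy e].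
by apply/(Ginj _ _ Gx Gy).
Qed.

Lemma infinite_nonempty T : [set: nat] #<= [set: T] -> [set: T] !=set0.
Proof. by move=> Tinf; apply: infinite_setN0; apply/infiniteP. Qed.

(* Zorn's lemma on the graphs of injections [A `*` A -> A], [A] infinite: if
   the complement of a maximal [A] contained a copy [h @` A] of [A], the
   injection would extend to the square of [A `|` h @` A]. *)
Lemma card_square T : [set: nat] #<= [set: T] -> [set: T * T] #<= [set: T].
Proof.
move=> Tinf.
(* The domain of [G] is to be the square of [dom G], read off the diagonal. In [P], infinity is
   asked only of a non-empty [G], which lets in the union of the empty chain. *)
pose dom (G : set ((T * T) * T)) := [set x | exists z, G ((x, x), z)].
pose P (G : set ((T * T) * T)) :=
  [/\ forall p q, G p -> G q -> (p.1 = q.1 <-> p.2 = q.2),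
      forall x y z, G ((x, y), z) -> [/\ dom G x, dom G y & dom G z],
      forall x y, dom G x -> dom G y -> exists z, G ((x, y), z)
    & G !=set0 -> [set: nat] #<= dom G].
have domS G H : G `<=` H -> dom G `<=` dom H.
  by move=> GH x [z Gz]; exists z; exact: GH.
have [F FP Ftot|G [[Ginj Gdom Gall Ginf] Gmax]] := @Zorn_bigcup _ P.
  split.
  - move=> p q [X FX Xp] [Y FY Yq]; have [XY|YX] := Ftot _ _ FX FY.
      by have [h _ _ _] := FP _ FY; apply: h => //; exact: XY.
    by have [h _ _ _] := FP _ FX; apply: h => //; exact: YX.
  - move=> x y z [X FX Xp]; have [_ /(_ _ _ _ Xp)[dx dy dz] _ _] := FP _ FX.
    have XU := domS _ _ (bigcup_sup FX : X `<=` \bigcup_(X in F) X).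
    by split; apply: XU.
  - move=> x y [z [X FX Xz]] [w [Y FY Yw]].
    have [XY|YX] := Ftot _ _ FX FY.
      have [_ _ h _] := FP _ FY.
      have [||v Yv] := h x y; [by exists z; apply: XY|by exists w|].
      by exists v; exists Y.
    have [_ _ h _] := FP _ FX.
    have [||v Yv] := h x y; [by exists z|by exists w; apply: YX|].
    by exists v; exists X.
  - move=> [p [X FX Xp]]; have [_ _ _ /(_ (ex_intro _ _ Xp)) h] := FP _ FX.
    apply: card_le_trans h (subset_card_le _); apply: domS; exact: bigcup_sup.
have [t0 _] := infinite_nonempty Tinf.
have [em einj] := inj_of_card_leT t0 Tinf.
pose A := dom G.
(* The empty graph is not maximal: a pairing of [nat], copied by [em], is larger. *)
have G0 : G !=set0.
  apply: contrapT => /set0P/negP/negPn/eqP G0.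
  have [c cinj] : exists c : nat * nat -> nat, injective c.
    apply: (@inj_of_card_leT _ _ 0%N).
    by have := card_nat2; rewrite card_eq_le => /andP[].
  pose H := [set p : (T * T) * T | exists m n, p = ((em m, em n), em (c (m, n)))].
  have domH m : dom H (em m) by exists (em (c (m, m))), m, m.
  have domHE x : dom H x -> exists m, x = em m.
    by case=> z [m [n [-> _ _]]]; exists m.
  apply: (Gmax H).
    by rewrite G0; split=> // /(_ ((em 0%N, em 0%N), em (c (0, 0)%N)))[]; exists 0%N, 0%N.
  split.
  - move=> _ _ [m [n ->]] [m' [n' ->]] /=; split=> [[/einj -> /einj -> //]|].
    by move=> /einj/cinj[-> ->].
  - by move=> x y z [m [n [-> -> ->]]]; split; exact: domH.
  - move=> x y /domHE[m ->] /domHE[n ->]; exists (em (c (m, n))).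
    by exists m, n.
  - by move=> _; apply: (card_le_inj (f := em)) => [m _|m n _ _ /einj//].
have /choice[f0 f0G] : forall p : T * T, exists z, A p.1 -> A p.2 -> G (p, z).
  move=> [x y]; have [[Ax Ay]|nA] := pselect (A x /\ A y).
    by have [z Gz] := Gall _ _ Ax Ay; exists z.
  by exists t0 => Ax Ay; case: nA.
pose f x y := f0 (x, y).
have fG x y : A x -> A y -> G ((x, y), f x y) by move=> Ax Ay; exact: (f0G (x, y)).
have fA x y : A x -> A y -> A (f x y).
  by move=> Ax Ay; have [] := Gdom _ _ _ (fG _ _ Ax Ay).
have finj x y x' y' : A x -> A y -> A x' -> A y' -> f x y = f x' y' -> x = x' /\ y = y'.
  move=> Ax Ay Ax' Ay' ef.
  by have /= [_ /(_ ef)[-> ->]] := Ginj _ _ (fG _ _ Ax Ay) (fG _ _ Ax' Ay').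
have [i0 i0A i0inj] := inj_of_card_le t0 (Ginf G0).
have iA n : A (i0 n) by exact: i0A.
have i01 : i0 0%N <> i0 1%N by move=> /i0inj => /(_ I I).
(* [f] with first argument [i0 0] or [i0 1] gives two disjoint copies of [A] inside [A]: one
   receives the points of [A], the other those that [r] sends into [A]. *)
have tagged (D : set T) (r : T -> T) :
    (forall x, D x -> ~ A x -> A (r x)) ->
    (forall x y, D x -> D y -> ~ A x -> ~ A y -> r x = r y -> x = y) ->
  exists q : T -> T, (forall x, D x -> A (q x)) /\
    forall x y, D x -> D y -> q x = q y -> x = y.
  move=> rA rinj.
  exists (fun x => if pselect (A x) then f (i0 0%N) x else f (i0 1%N) (r x)).
  split=> [x Dx|x y Dx Dy]; first by case: pselect => Ax; apply: fA => //; exact: rA.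
  case: pselect => Ax; case: pselect => Ay.
  - by move=> /finj[].
  - by move=> /finj[]//; exact: rA.
  - by move=> /finj[]//; [exact: rA|move=> /esym].
  - by move=> /finj[]//; [exact: rA|exact: rA|move=> _; exact: rinj].
have [/(inj_of_card_le t0)[r rA rinj]|/(inj_of_card_le t0)[h hA hinj]] :=
    card_le_total (~` A) A.
  have [||q [qA qinj]] := tagged setT r.
  - by move=> x _; exact: rA.
  - by move=> x y _ _; exact: rinj.
  apply: (card_leT_inj (f := fun p => f (q p.1) (q p.2))) => -[x y] [x' y'] /=.
  move=> /finj[]; [exact: qA|exact: qA|exact: qA|exact: qA|].
  by move=> /qinj-> // /qinj->.
pose A' := A `|` h @` A.
have /choice[r rh] : forall y, exists x, (h @` A) y -> A x /\ h x = y.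
  move=> y; have [[x Ax <-]|ny] := pselect ((h @` A) y); first by exists x.
  by exists t0.
have [||q [qA qinj]] := tagged A' r.
- by move=> x [//|/rh[]].
- move=> x y [//|/rh[_ hx]] [//|/rh[_ hy]] _ _ e.
  by rewrite -hx -hy e.
pose E := [set p : (T * T) * T | [/\ A' p.1.1, A' p.1.2, ~ (A p.1.1 /\ A p.1.2)
  & p.2 = h (f (q p.1.1) (q p.1.2))]].
have EA p : E p -> ~ A p.2.
  by case: p => -[x y] z [/= A'x A'y _ -> ]; apply: hA; apply: fA; exact: qA.
have EA' p : E p -> A' p.2.
  case: p => -[x y] z [/= A'x A'y _ -> ].
  by right; exists (f (q x) (q y)) => //; apply: fA; exact: qA.
have GA p : G p -> [/\ A p.1.1, A p.1.2 & A p.2].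
  by case: p => -[x y] z /Gdom[].
have domGE x : dom (G `|` E) x -> A' x.
  by case=> z [/GA[Ax _ _]|[]//]; left.
have EGdom x : A' x -> dom (G `|` E) x.
  move=> A'x; have [Ax|nAx] := pselect (A x).
    by exists (f x x); left; exact: fG.
  by exists (h (f (q x) (q x))); right; split=> //= -[].
case: (Gmax (G `|` E)).
  split; first by move=> ? ?; left.
  move=> GE; have A'y : A' (h (i0 0%N)) by right; exists (i0 0%N).
  have nAy : ~ A (h (i0 0%N)) by exact: hA.
  pose y := h (i0 0%N).
  have : E ((y, y), h (f (q y) (q y))) by split=> //= -[].
  by move=> Ey; have /GE/GA[] : (G `|` E) ((y, y), h (f (q y) (q y))) by right.
split.
- move=> p1 p2 [Gp1|Ep1] [Gp2|Ep2].
  + exact: Ginj.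
  + split=> e.
      by case: Ep2 => _ _; rewrite -e; have [Ax Ay _] := GA _ Gp1 => -[].
    by have := EA _ Ep2; rewrite -e; have [] := GA _ Gp1.
  + split=> e.
      by case: Ep1 => _ _; rewrite e; have [Ax Ay _] := GA _ Gp2 => -[].
    by have := EA _ Ep1; rewrite e; have [] := GA _ Gp2.
  + case: p1 p2 Ep1 Ep2 => -[x1 y1] z1 [[x2 y2] z2] [/= ? ? ? ->] [/= ? ? ? ->].
    split=> [[-> ->]//|/hinj e].
    have [] : q x1 = q x2 /\ q y1 = q y2.
      by apply: finj; [exact: qA..|apply: e; apply: fA; exact: qA].
    by move=> /qinj-> // /qinj->.
- move=> x y z [/GA[/= Ax Ay Az]|Ep].
    by split; apply: EGdom; left.
  by split; apply: EGdom; [case: Ep|case: Ep|exact: (EA' _ Ep)].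
- move=> x y /domGE A'x /domGE A'y.
  have [[Ax Ay]|nA] := pselect (A x /\ A y).
    by exists (f x y); left; exact: fG.
  by exists (h (f (q x) (q y))); right.
- move=> _; apply: card_le_trans (Ginf G0) (subset_card_le _).
  by move=> x Ax; apply: EGdom; left.
Qed.

(** Iterated pairing is injective on lists of equal length; the length is stored beside it. *)
Lemma card_list T : [set: nat] #<= [set: T] -> [set: seq T] #<= [set: T].
Proof.
move=> Tinf; have [t0 _] := infinite_nonempty Tinf.
have [e einj] := inj_of_card_leT t0 Tinf.
have [q qinj] := inj_of_card_leT t0 (card_square Tinf).
have codeinj s t : size s = size t ->
    foldr (fun x y => q (x, y)) t0 s = foldr (fun x y => q (x, y)) t0 t -> s = t.
  by elim: s t => [|x s IH] [|y t] //= [/IH{}IH] /qinj[-> /IH->].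
apply: (card_leT_inj (f := fun s => q (e (size s), foldr (fun x y => q (x, y)) t0 s))).
by move=> s t /qinj[/einj es ec]; exact: codeinj.
Qed.

Lemma card_seq_set T : [set: nat] #<= [set: T] ->
  [set: seq (set T)] #<= [set: set T].
Proof.
move=> Tinf; have [t0 _] := infinite_nonempty Tinf.
have [e einj] := inj_of_card_leT t0 Tinf.
have [q qinj] := inj_of_card_leT t0 (card_square Tinf).
(* [q (e n, q (e 0, t))] says that [t] is in the [n]-th set, [q (e n, q (e 1, t0))]
   that there is an [n]-th set. *)
pose c (s : seq (set T)) : set T := [set x | exists2 n, (n < size s)%N &
  (exists2 t, nth set0 s n t & x = q (e n, q (e 0%N, t))) \/
  x = q (e n, q (e 1%N, t0))].
have csize s t : c s `<=` c t -> (size s <= size t)%N.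
  move=> cst; case es : (size s) => [//|n].
  have /cst[m mt] : c s (q (e n, q (e 1%N, t0))) by exists n; [rewrite es|right].
  by case=> [[? _]|] /qinj[/einj ->] // /qinj[/einj].
have cnth s t n : (n < size s)%N -> c s `<=` c t -> nth set0 s n `<=` nth set0 t n.
  move=> ns cst x sx; have /cst[m mt] : c s (q (e n, q (e 0%N, x))).
    by exists n => //; left; exists x.
  case=> [[y ty] /qinj[/einj -> /qinj[->]]//|].
  by move=> /qinj[/einj _ /qinj[/einj]].
apply: (card_leT_inj (f := c)) => s t cst.
have /seteqP[st ts] := cst.
have sst : size s = size t by apply/eqP; rewrite eqn_leq !csize.
apply: (@eq_from_nth _ set0) => // n ns; apply/seteqP; split; apply: cnth => //.
by rewrite -sst.
Qed.

(** * Transfinite recursion by choice *)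

Lemma wf_choice K V (lt : K -> K -> Prop) (v0 : V)
    (P : K -> set (K * V) -> V -> Prop) : well_founded lt ->
  exists g : K -> V, forall k, let U := [set (j, g j) | j in lt^~ k] in
    (exists y, P k U y) -> P k U (g k).
Proof.
move=> wf.
(* When no value satisfies [P], the default [v0] is taken; [g] is thus total, and the success of
   each stage can be proved afterwards. *)
pose step k (rec : forall j, lt j k -> V) :=
  let U := [set p | exists h : lt p.1 k, p.2 = rec p.1 h] in
  if pselect (exists y, P k U y) is left e then projT1 (cid e) else v0.
pose g := Fix wf (fun=> V) step.
have gE k : g k = step k (fun j _ => g j).
  rewrite /g Fix_eq // => x f1 f2 f12; congr step.
  by apply/functional_extensionality_dep => j; apply/functional_extensionality_dep.
exists g => k U eP; rewrite gE /step.
set U' := [set p | _]; have -> : U' = U.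
  apply/seteqP; split=> -[j y] /=; first by case=> h /= ->; exists j.
  by case=> i ik [<- <-]; exists ik.
by case: pselect => // e; exact: projT2 (cid e).
Qed.

Local Open Scope ring_scope.

(** * There are at most continuum many closed sets of reals *)

Section Ternary.
Variable R : realType.

Let third_gt0 n : 0 < (3^-1 : R) ^+ n.
Proof. by rewrite exprn_gt0 // invr_gt0. Qed.

(** With digits 0 and 1, base 3 makes expansions unique, which base 2 would not. *)
Definition ternary (A : set nat) (n : nat) : R :=
  \sum_(i < n) (if `[< A i >] then 3^-1 ^+ i else 0).

Lemma ternary_ge0 (A : set nat) i : 0 <= (if `[< A i >] then 3^-1 ^+ i else 0 : R).
Proof. by case: ifP => // _; exact: ltW. Qed.

Lemma ternaryS A n :
  ternary A n.+1 = ternary A n + (if `[< A n >] then 3^-1 ^+ n else 0).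
Proof. by rewrite /ternary big_ord_recr. Qed.

Lemma ternary_homo A : {homo ternary A : m n / (m <= n)%N >-> m <= n}.
Proof.
move=> m n /subnK <-; elim: (n - m)%N => // k IH; apply: (le_trans IH).
by rewrite addSn ternaryS lerDl ternary_ge0.
Qed.

Lemma ternary_tail A n k : ternary A (n + k) <= ternary A n + 3 / 2 * 3^-1 ^+ n.
Proof.
(* [3 / 2 * 3^-1 ^+ n] is the whole geometric tail from [n]; subtracting the part from [n + k] on
   makes the bound inductive. *)
suff h : ternary A (n + k) <= ternary A n + 3 / 2 * 3^-1 ^+ n - 3 / 2 * 3^-1 ^+ (n + k).
  by apply: (le_trans h); have := third_gt0 (n + k); lra.
elim: k => [|k IH]; first by rewrite addn0 addrK.
rewrite addnS ternaryS exprS.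
have p0 := ltW (third_gt0 (n + k)).
set d := (if _ then _ else _); have : d <= (3^-1 : R) ^+ (n + k) by rewrite /d; case: ifP.
move: d IH p0 => d; set y := 3^-1 ^+ (n + k); set z := 3^-1 ^+ n.
by set a := ternary A (n + k); lra.
Qed.

Definition ternary_real A : R := sup (range (ternary A)).

Lemma ternary_sup A n : ternary A n <= ternary_real A <= ternary A n + 3 / 2 * 3^-1 ^+ n.
Proof.
have ub m : ternary A m <= ternary A n + 3 / 2 * 3^-1 ^+ n.
  apply: le_trans (ternary_tail A n m); apply: ternary_homo; exact: leq_addl.
apply/andP; split.
  apply: ub_le_sup; last by exists n.
  by exists (ternary A n + 3 / 2 * 3^-1 ^+ n) => _ [m _ <-].
by apply: ge_sup; [exists (ternary A 0), 0%N|move=> _ [m _ <-]].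
Qed.

Lemma ternary_real_inj : injective ternary_real.
Proof.
(* At the first difference [A] gains [3^-1 ^+ n], while all later digits of [B] add at most half of
   that. *)
have main A B n : (forall i, (i < n)%N -> A i = B i) -> A n -> ~ B n ->
    ternary_real A <> ternary_real B.
  move=> ABn An Bn e.
  have /andP[+ _] := ternary_sup A n.+1; have /andP[_] := ternary_sup B n.+1.
  rewrite e /ternary !big_ord_recr /= (asboolT An) (asboolF Bn).
  under eq_bigr => i _ do rewrite -(ABn _ (ltn_ord i)).
  have p0 := third_gt0 n.
  move: p0; rewrite exprS; move: (3^-1 ^+ n) (\sum_(i < n) _) (ternary_real B).
  by move=> x s y *; lra.
move=> A B e; apply: contrapT => /eqP AB.
have [n nP] : exists n, `[< ~ (A n <-> B n) >].
  apply: contrapT => h; move/eqP: AB; apply; apply/seteqP; split=> n.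
    by move=> An; apply: contrapT => Bn; apply: h; exists n; apply/asboolP; tauto.
  by move=> Bn; apply: contrapT => An; apply: h; exists n; apply/asboolP; tauto.
have [m /asboolP mP mmin] := ex_minnP (ex_intro (fun n => `[< ~ (A n <-> B n) >] = true) n nP).
have eqm i : (i < m)%N -> A i = B i.
  move=> im; apply/propext; apply: contrapT => /asboolP/mmin.
  by rewrite leqNgt im.
have [Am|nAm] := pselect (A m); have [Bm|nBm] := pselect (B m).
- by apply: mP.
- exact: (main A B m).
- by apply: (main B A m) => // i /eqm.
- by apply: mP; tauto.
Qed.

Lemma card_set_nat_real : [set: set nat] #<= [set: R].
Proof. exact: card_leT_inj ternary_real_inj. Qed.

(** A closed set is determined by which of the countably many rational open intervals miss it. *)
Lemma card_closed_real : [set C : set R | closed C] #<= [set: R].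
Proof.
apply: card_le_trans card_set_nat_real.
pose D (C : set R) : set nat := [set n | exists p q : rat,
  n = pickle (p, q) /\ forall x, ratr p < x < ratr q -> ~ C x].
apply: (card_le_inj (f := D)) => //.
suff main A B : closed B -> D B `<=` D A -> A `<=` B.
  move=> A B cA cB DAB; apply/seteqP; split; apply: main => //; rewrite DAB //.
move=> cB DAB x Ax; apply: contrapT => nBx.
have /nbhs_ballP[e /= e0 xeB] : nbhs x (~` B).
  by apply: open_nbhs_nbhs; split=> //; exact: closed_openC.
have /rat_in_itvoo[p] : x - e < x by rewrite ltrBlDr ltrDl.
have /rat_in_itvoo[q] : x < x + e by rewrite ltrDl.
rewrite !in_itv /= => /andP[xq qx] /andP[xp px].
have /DAB[p' [q' [/(pcan_inj pickleK)[<- <-] /(_ x)]]] : D B (pickle (p, q)).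
  exists p, q; split=> // y /andP[py yq]; apply: xeB; rewrite /ball /= ltr_norml.
  by apply/andP; split; lra.
by rewrite px xq => /(_ isT).
Qed.

End Ternary.

(** * Scaling of null sets; closed sets of positive measure *)

Section Lebesgue.
Variable R : realType.
Local Notation mu := (@lebesgue_measure R).

(** [c] times the push-forward of Lebesgue measure under multiplication by [c] agrees with Lebesgue
    measure on half-open intervals, hence on Borel sets. *)
Lemma leb_null_scale (c : R) (A : set R) : 0 < c ->
  leb_null [set c * x | x in A] -> leb_null A.
Proof.
move=> c0 [N [mN N0 AN]].
pose f (x : measurableTypeR R) : measurableTypeR R := c * x.
have mf : measurable_fun setT f by exact: mulrl_measurable.
pose push : {measure set (measurableTypeR R) -> \bar R} :=
  measure_function_pushforward__canonical__measure_function_Measure mu mf.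
pose nu : {measure set (measurableTypeR R) -> \bar R} := mscale (NngNum (ltW c0)) push.
have nuE X : ocitv X -> mu X = nu X.
  case=> -[a b] _ <- /=.
  rewrite /nu /mscale /= /pushforward.
  have -> : f @^-1` `]a, b] = `]a / c, b / c]%classic.
    apply/seteqP; split=> x /=; rewrite !in_itv /= ltr_pdivrMr // ler_pdivlMr // /f mulrC //.
  rewrite !lebesgue_measure_itv /= !lte_fin ltr_pM2r ?invr_gt0 //.
  case: ifP => _; last by rewrite mule0.
  by rewrite -!EFinB -EFinM -mulrBl mulrCA divff ?mulr1 // gt_eqF.
exists (f @^-1` N); split.
- by rewrite -[X in measurable X]setTI; apply: (mf).
- have : nu N = 0%E by rewrite -(lebesgue_measure_unique nuE).
  rewrite /nu /mscale /= /pushforward => /eqP; rewrite mule_eq0.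
  by rewrite eqe gt_eqF //= => /eqP.
- by move=> x Ax; apply: AN; exists x.
Qed.

(* [phi x = mu (C `&` ]-oo, x])] is continuous, so it takes every value of
   [[0, mu C]]; a positive value taken at [c] is taken at [sup (C `&` ]-oo, c])],
   which belongs to [C]. *)
Lemma card_closed_pos (C : set R) : closed C -> C `<=` `[0, 1]%classic ->
  (0 < mu C)%E -> [set: R] #<= C.
Proof.
move=> cC C01 C0.
have mC : measurable (C : set (measurableTypeR R)) by exact: closed_measurable.
pose S x : set (measurableTypeR R) := C `&` `]-oo, x]%classic.
have mS x : measurable (S x) by exact: measurableI.
have muC : (mu C < +oo)%E.
  apply: (@le_lt_trans _ _ (mu `[0, 1]%classic)); last first.
    by rewrite lebesgue_measure_itv /= lte_fin ltr01 -EFinB ltry.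
  by apply: le_measure; rewrite ?inE.
have muS x : mu (S x) \is a fin_num.
  rewrite ge0_fin_numE //; apply: le_lt_trans muC.
  by apply: le_measure; rewrite ?inE // => ? [].
pose phi x := fine (mu (S x)).
have phiE x : mu (S x) = (phi x)%:E by rewrite fineK.
have phi_homo x y : x <= y -> phi x <= phi y.
  move=> xy; rewrite -lee_fin -!phiE; apply: le_measure; rewrite ?inE //.
  by move=> z [Cz]; rewrite /= !in_itv /= => zx; split=> //=; rewrite in_itv /= (le_trans zx).
have phi_lip x y : x <= y -> phi y <= phi x + (y - x).
  move=> xy; rewrite -lee_fin EFinD -!phiE.
  have -> : (y - x)%:E = mu `]x, y]%classic.
    rewrite lebesgue_measure_itv /= lte_fin; case: ltP => // yx.
    have -> : y = x by apply/le_anti/andP; split.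
    by rewrite subrr.
  have mI : measurable (`]x, y]%classic : set (measurableTypeR R)) by [].
  apply: (@le_trans _ _ (mu (S x `|` `]x, y]%classic))); last first.
    exact: (measureU2 mu (mS x) mI).
  apply: le_measure; rewrite ?inE //; first exact: measurableU.
  move=> z [Cz]; rewrite /= !in_itv /= => zy; have [zx|xz] := leP z x.
    by left; split.
  by right; rewrite /= ?in_itv /= ?xz.
have phi_dist x y : `|phi x - phi y| <= `|x - y|.
  wlog xy : x y / x <= y.
    by move=> h; have [/h//|/ltW/h] := leP x y; rewrite distrC (distrC y).
  rewrite distrC ger0_norm ?subr_ge0 ?phi_homo //.
  by rewrite distrC ger0_norm ?subr_ge0 // lerBlDl phi_lip.
have phi0 : phi (-1) = 0.
  rewrite /phi; suff -> : S (-1) = set0 by rewrite measure0.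
  apply/seteqP; split=> // x [/C01]; rewrite /= !in_itv /= => /andP[x0 _] x1.
  by have := le_trans x0 x1; rewrite oppr_ge0 ler10.
have phi1 : mu C = (phi 1)%:E.
  rewrite -phiE; congr (mu _); apply/seteqP; split=> [x Cx|x []//].
  by split=> //; have := C01 _ Cx; rewrite /= !in_itv /= => /andP[].
have pos : 0 < phi 1 by rewrite -lte_fin -phi1.
have point v : exists x, 0 < v <= phi 1 -> C x /\ phi x = v.
  have [/andP[v0 v1]|nv] := boolP (0 < v <= phi 1); last by exists 0.
  have [|||c _ cv] := @IVT R phi (-1) 1 v.
  - by lra.
  - apply: continuous_subspaceT => x; apply/cvgrPdist_lt => e e0.
    near=> y; apply: (le_lt_trans (phi_dist _ _)).
    by near: y; exact: cvgr_dist_lt.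
  - by rewrite phi0 ge_min le_max ltW //= v1 orbT.
  have Sc : S c !=set0.
    apply/set0P; apply: contraTneq v0 => Sc0.
    by rewrite -cv /phi Sc0 measure0 ltxx.
  have ubS : has_ubound (S c).
    by exists c => y [_]; rewrite /= in_itv.
  have cS : closed (S c) by apply: closedI => //; exact: itv_closed.
  have [Cs sc] : S c (sup (S c)).
    by have := closure_sup Sc ubS; rewrite -((closure_id _).1 cS).
  exists (sup (S c)) => _; split=> //; rewrite -cv /phi; congr (fine (mu _)).
  apply/seteqP; split=> z [Cz]; rewrite /= !in_itv /= => zs; split=> //=; rewrite in_itv /=.
    by move: sc; rewrite /= in_itv /=; exact: le_trans.
  by apply: ub_le_sup => //; split=> //=; rewrite ?in_itv.
have /choice[g gP] := point.
(* A logistic curve, which injects the line into the values between 0 and [mu C]. *)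
pose v (x : R) := phi 1 / (1 + expR x).
have vpos x : 0 < v x <= phi 1.
  have e0 := expR_gt0 x.
  rewrite divr_gt0 ?addr_gt0 //= ler_pdivrMr ?addr_gt0 //.
  by rewrite mulrDr mulr1 lerDl mulr_ge0 // ltW.
apply: (card_le_inj (f := g \o v)) => [x _|x y _ _ /= e].
  by have [] := gP _ (vpos x).
have [_ vx] := gP _ (vpos x); have [_ vy] := gP _ (vpos y).
have : v x = v y by rewrite -vx -vy e.
rewrite /v => /(mulfI (lt0r_neq0 pos))/invr_inj/addrI/expR_inj //.
Unshelve. all: by end_near. Qed.

(** The Borel part [B] of [Z] has positive finite measure, and inner regularity with error below
    [mu B] itself gives a compact subset that cannot be null. *)
Lemma leb_measurable_closed_sub (Z : set R) : Z `<=` `[0, 1]%classic ->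
  leb_measurable_set Z -> ~ leb_null Z ->
  exists C : set R, [/\ closed C, C `<=` Z & (0 < mu C)%E].
Proof.
move=> Z01 [B mB [N N0 BNZ]] Znull.
have BZ : B `<=` Z by rewrite -BNZ => x; left.
have B0 : (0 < mu B)%E.
  rewrite lt0e measure_ge0 andbT; apply: contra_notN Znull => /eqP B0.
  by rewrite -BNZ; apply: negligibleU => //; exists B; split.
have Boo : (mu B < +oo)%E.
  apply: (@le_lt_trans _ _ (mu `[0, 1]%classic)); last first.
    by rewrite lebesgue_measure_itv /= lte_fin ltr01 -EFinB ltry.
  by apply: le_measure; rewrite ?inE //; exact: subset_trans BZ Z01.
have fB : mu B \is a fin_num by rewrite ge0_fin_numE.
have fB0 : 0 < fine (mu B) by rewrite -lte_fin fineK.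
have [V [cV VB muV]] := lebesgue_regularity_inner mB Boo fB0.
have clV : closed V by exact: compact_closed.
exists V; split=> //; first exact: subset_trans VB BZ.
rewrite lt0e measure_ge0 andbT; apply: contraTneq muV => V0.
have mV : measurable (V : set (measurableTypeR R)) by exact: closed_measurable.
rewrite -leNgt fineK //.
have -> : mu B = (mu (B `\` V) + mu V)%E.
  by rewrite -{2}(setIidr VB); exact: measureDI.
by rewrite V0 adde0.
Qed.

End Lebesgue.

(** * Algebraically independent functions indexed by the subsets of [K] *)

Lemma perm_eq_digits (D : nat) (s t : seq nat) : (size s < D)%N -> (size t < D)%N ->
  (\sum_(i <- s) D ^ i = \sum_(i <- t) D ^ i)%N -> perm_eq s t.
Proof.
move=> sD tD e; apply/allP => j _ /=; apply/eqP.
(* Fewer than [D] terms produce no carry: the lowest base-[D] digit counts the zeros, and [shift]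
   divides the rest by [D]. *)
pose shift (s : seq nat) := [seq i.-1 | i <- s & (0 < i)%N].
have shiftE u : (\sum_(i <- u) D ^ i = D * \sum_(i <- shift u) D ^ i + count_mem 0 u)%N.
  elim: u => [|[|i] u IH]; first by rewrite !big_nil muln0.
    by rewrite big_cons IH /= expn0 addnCA.
  by rewrite big_cons IH /= big_cons /= expnS add0n mulnDr addnA.
have count_shift u i : count_mem i (shift u) = count_mem i.+1 u.
  by elim: u => [//|[|k] u /= IH]; rewrite ?add0n -?IH.
have size_shift u : (size (shift u) <= size u)%N.
  by rewrite size_map size_filter count_size.
have D0 : (0 < D)%N by apply: leq_ltn_trans sD.
have c0 u : (size u < D)%N -> ((\sum_(i <- u) D ^ i) %% D = count_mem 0 u)%N.
  by move=> uD; rewrite shiftE mulnC modnMDl modn_small // (leq_ltn_trans (count_size _ _)).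
elim: j s t sD tD e => [|j IH] s t sD tD e; first by rewrite -!c0 // e.
rewrite -!count_shift; apply: IH.
- exact: leq_ltn_trans (size_shift s) sD.
- exact: leq_ltn_trans (size_shift t) tD.
have e0 : count_mem 0%N s = count_mem 0%N t by rewrite -!c0 // e.
by move/eqP: e; rewrite (shiftE s) (shiftE t) e0 eqn_add2r eqn_pmul2l // => /eqP.
Qed.

Lemma poly_nat_eq0 (R : numDomainType) (p : {poly R}) :
  (forall x : nat, p.[x%:R] = 0) -> p = 0.
Proof.
move=> p0; apply/eqP; apply: contraT => pn0.
have := @max_poly_roots _ p [seq x%:R | x <- iota 0 (size p)] pn0.
rewrite size_map size_iota ltnn; apply.
  by apply/allP => _ /mapP[x _ ->]; apply/eqP.
by rewrite map_inj_uniq ?iota_uniq // => x y /eqP; rewrite eqr_nat => /eqP.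
Qed.

Section Independent.
Variables (R : numDomainType) (K : Type).

Definition trace_code (F : seq K) (S : set K) : nat := pickle [seq `[< S k >] | k <- F].

(** For fixed [F] and [D] a monomial in these functions is a single power of [x], so a linear
    combination of monomials is a polynomial in [x]. *)
Definition indep (S : set K) (i : seq K * nat * nat) : R :=
  i.2%:R ^+ (i.1.2 ^ trace_code i.1.1 S).

Definition indep_mon (s : seq (set K)) (i : seq K * nat * nat) : R :=
  \prod_(S <- s) indep S i.

Definition weight (F : seq K) (D : nat) (s : seq (set K)) : nat :=
  \sum_(S <- s) D ^ trace_code F S.

Lemma indep_monE s F D x : indep_mon s (F, D, x) = x%:R ^+ weight F D s.
Proof.
by rewrite /indep_mon /weight (big_morph _ (exprD _) (expr0 _)).
Qed.

(** [F] lists, for each pair of distinct members of [L], a point at which they differ. *)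
Lemma trace_separates (L : seq (set K)) :
  exists F, {in L &, injective (trace_code F)}.
Proof.
have [[k0 _]|nK] := pselect (exists k : K, True); last first.
  by exists [::] => S T _ _ _; apply/seteqP; split=> k _; case: nK; exists k.
have /choice[d dP] : forall p : set K * set K, exists k, p.1 <> p.2 -> ~ (p.1 k <-> p.2 k).
  move=> [S T] /=; have [->|ST] := pselect (S = T); first by exists k0.
  apply: contrapT => h; apply: ST; apply/seteqP; split=> k.
    by move=> Sk; apply: contrapT => nTk; apply: h; exists k => _; tauto.
  by move=> Tk; apply: contrapT => nSk; apply: h; exists k => _; tauto.
exists [seq d p | p <- allpairs pair L L] => S T SL TL.
move=> /(pcan_inj pickleK); rewrite -!map_comp => /eq_in_map/(_ (S, T)) /=.
rewrite allpairs_f // => /(_ isT) e; apply: contrapT => ST.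
apply: (dP (S, T) ST) => /=.
by split=> /asboolP; [rewrite e|rewrite -e] => /asboolP.
Qed.

(* If [F] separates the sets involved and [D] exceeds the lengths, the
   multiplicities of a monomial are the base-[D] digits of its weight. *)
Lemma weight_separates (L : seq (seq (set K))) :
  exists F D, {in L &, forall s t, weight F D s = weight F D t -> perm_eq s t}.
Proof.
have [F Finj] := trace_separates (flatten L).
pose D := (\max_(s <- L) size s).+1.
have LD s : s \in L -> (size s < D)%N by move=> sL; rewrite ltnS; exact: leq_bigmax_seq.
(* [dec] inverts the coding on the sets involved, so a permutation of codes lifts to one of sets. *)
have /choice[dec decP] : forall n, exists S, forall T, T \in flatten L ->
    trace_code F T = n -> T = S.
  move=> n; have [[S [SL Sn]]|h] := pselect (exists S, S \in flatten L /\ trace_code F S = n).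
    by exists S => T TL Tn; apply: Finj => //; rewrite Tn.
  by exists set0 => T TL Tn; case: h; exists T.
have mapK s : s \in L -> [seq dec n | n <- map (trace_code F) s] = s.
  move=> sL; rewrite -map_comp -[RHS]map_id; apply/eq_in_map => S Ss /=.
  by apply/esym/decP => //; apply/flattenP; exists s.
exists F, D => s t sL tL e.
rewrite -(mapK _ sL) -(mapK _ tL); apply/perm_map/(@perm_eq_digits D).
- by rewrite size_map LD.
- by rewrite size_map LD.
by rewrite !big_map.
Qed.

(** For separating [F] and [D], both sides are polynomials agreeing at all natural [x]; the
    coefficients at the weight of [t] are compared. Taking [a = 0] gives linear independence,
    [a = 1] minimality of the generators. *)
Lemma indep_mon_coef n (c : 'I_n -> R) (s : 'I_n -> seq (set K)) (a : R) t :
  (forall i, \sum_(j < n) c j * indep_mon (s j) i = a * indep_mon t i) ->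
  \sum_(j < n | perm_eq (s j) t) c j = a.
Proof.
move=> e; have [F [D wP]] := weight_separates (t :: [seq s j | j <- enum 'I_n]).
have sP j : (weight F D (s j) == weight F D t) = perm_eq (s j) t.
  apply/eqP/idP => [|/(perm_big _)]; last exact.
  by apply: wP; rewrite ?inE ?eqxx // map_f ?orbT // mem_enum.
pose p : {poly R} := \sum_(j < n) c j *: 'X^(weight F D (s j)) - a *: 'X^(weight F D t).
have p0 : p = 0.
  apply: poly_nat_eq0 => x; rewrite hornerD hornerN hornerZ hornerXn horner_sum.
  rewrite -indep_monE -e -sumrN -big_split /= big1 // => j _.
  by rewrite hornerZ hornerXn indep_monE subrr.
have := congr1 (fun q : {poly R} => q`_(weight F D t)) p0.
rewrite coefB coefZ coefXn eqxx mulr1 coef0 coef_sum => /eqP; rewrite subr_eq0 => /eqP <-.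
rewrite [LHS]big_mkcond; apply: eq_bigr => j _.
by rewrite coefZ coefXn eq_sym sP; case: ifP; rewrite ?mulr1 ?mulr0.
Qed.

Lemma indep_mon_perm s t : indep_mon s = indep_mon t -> perm_eq s t.
Proof.
move=> e; have := @indep_mon_coef 1 (fun=> 1) (fun=> s) 1 t.
rewrite [X in _ -> X = _]big_mkcond big_ord1 /= => h.
suff: (if perm_eq s t then 1 else 0) = 1 :> R.
  by case: ifP => // _ /eqP; rewrite eq_sym oner_eq0.
by apply: h => i; rewrite big_ord1 e.
Qed.

Lemma indep_inj : injective indep.
Proof.
move=> S T e; have /perm_mem/(_ S) : perm_eq [:: S] [:: T].
  by apply: indep_mon_perm; apply/funext => i; rewrite /indep_mon !big_seq1 e.
by rewrite !inE eqxx => /esym/eqP.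
Qed.

End Independent.

Arguments indep {R K}.
Arguments indep_mon {R K}.

(** * From functions on the index set to sequences of functions *)

Section Transfer.
Variables (R : realType) (K : Type).
Local Notation index := (seq K * nat * nat)%type.
Variables (D : K -> R -> bool) (l : R -> index).
Hypothesis lD : forall i, exists a t, D a t /\ l t = i.

(** [D a] will be the [a]-th initial segment of [X], and [l] the labelling of the pieces. By [lD]
    every index is seen somewhere, whence injectivity. *)
Definition transfer (u : index -> R) : K -> R -> R :=
  fun a t => if D a t then u (l t) else 0.

Lemma transfer_inj : injective transfer.
Proof.
move=> u v e; apply/funext => i; have [a [t [Dat <-]]] := lD i.
by have := congr1 (fun h => h a t) e; rewrite /transfer Dat.
Qed.

Lemma transfer0 : transfer (fun=> 0) = @zero_seq R K.
Proof. by apply/funext => a; apply/funext => t; rewrite /transfer; case: ifP. Qed.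

Lemma transfer_sum n (c : 'I_n -> R) (u : 'I_n -> index -> R) :
  (fun a t => \sum_(i < n) c i * transfer (u i) a t) =
  transfer (fun x => \sum_(i < n) c i * u i x).
Proof.
apply/funext => a; apply/funext => t; rewrite /transfer; case: ifP => // _.
by rewrite big1 // => i _; rewrite mulr0.
Qed.

(** At least one factor is required: where [D] fails, an empty product would be 1 instead of 0. *)
Lemma transfer_prod n (u : 'I_n.+1 -> index -> R) :
  (fun a t => \prod_(i < n.+1) transfer (u i) a t) =
  transfer (fun x => \prod_(i < n.+1) u i x).
Proof.
apply/funext => a; apply/funext => t; rewrite /transfer; case: ifP => // _.
by rewrite big_ord_recl mul0r.
Qed.

Local Notation gen := (fun S : set K => transfer (@indep R K S)).
Local Notation mon := (fun s : seq (set K) => transfer (@indep_mon R K s)).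

Lemma monomials_range (X : set (set K)) h : monomials (gen @` X) h ->
  exists2 s, h = mon s & {in s, forall S, X S} /\ s != [::].
Proof.
move=> [n [m [mG ->]]]; have /choice[S SP] : forall i, exists S, X S /\ gen S = m i.
  by move=> i; have [S XS <-] := mG i; exists S.
exists [seq S i | i <- enum 'I_n.+1].
  have -> : m = fun i => gen (S i) by apply/funext => i; case: (SP i).
  rewrite transfer_prod; congr transfer; apply/funext => x.
  by rewrite /indep_mon big_map enumT.
split; last by rewrite -size_eq0 size_map size_enum_ord.
by move=> _ /mapP[i _ ->]; case: (SP i).
Qed.

(** As [transfer] is injective and respects linear combinations and non-empty products, all
    algebraic claims reduce to [indep_mon_coef]; the monomials form the basis. *)
Lemma algebrable_transfer (A : set (K -> R -> R)) : [set: nat] #<= [set: K] ->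
  (forall u : index -> R, (exists i, u i <> 0) -> A (transfer u)) ->
  algebrable A (set K).
Proof.
move=> Kinf uA; pose G := range gen.
have gen_inj : injective gen by move=> S T /transfer_inj/indep_inj.
have genG S : monomials G (gen S).
  exists 0%N, (fun=> gen S); split=> [_|]; first by exists S.
  by apply/funext => a; apply/funext => t; rewrite big_ord1.
have span_mon X h : gen_alg (gen @` X) h -> exists n c (s : 'I_n -> seq (set K)),
    [/\ h = transfer (fun x => \sum_(i < n) c i * indep_mon (s i) x),
     forall i, {in s i, forall S, X S} & forall i, s i != [::]].
  move=> [n [e [c [eG ->]]]].
  have /choice[s sP] : forall i, exists s, e i = mon s /\
      ({in s, forall S, X S} /\ s != [::]).
    by move=> i; have [s es sX] := monomials_range (eG i); exists s.
  exists n, c, s; split=> [|i|i]; [|by case: (sP i) => _ []..].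
  rewrite -transfer_sum; apply/funext => a; apply/funext => t.
  by apply: eq_bigr => i _; case: (sP i) => ->.
have cardG : (G #= [set: set K]) .
  apply: inj_card_eq; move=> S T _ _; exact: gen_inj.
exists (gen_alg G), G; split=> //; split; last split; last split=> //.
- move=> h /span_mon[n [c [s [-> _ _]]]] h0; apply: uA; apply: contrapT => u0.
  apply: h0; rewrite -transfer0; congr transfer; apply/funext => x.
  by apply: contrapT => ux; apply: u0; exists x.
- exists (monomials G); split; last split; last split=> //.
  + move=> h Gh; exists 1%N, (fun=> h), (fun=> 1); split=> // .
    by apply/funext => a; apply/funext => t; rewrite big_ord1 mul1r.
  + move=> n e c einj eG e0 i0.
    have /choice[s es] : forall i, exists s, e i = mon s.
      by move=> i; have [s es _] := monomials_range (eG i); exists s.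
    have {e0} h x : \sum_(j < n) c j * indep_mon (s j) x = 0 * indep_mon (s i0) x.
      rewrite mul0r; move: e0; rewrite (_ : e = fun i => mon (s i)); last exact/funext.
      by rewrite transfer_sum -transfer0 => /transfer_inj/(congr1 (fun u => u x)).
    rewrite -(indep_mon_coef h) (big_pred1 i0) // => j /=.
    apply/idP/eqP => [p|->//]; apply: einj; rewrite !es; congr transfer.
    by apply/funext => x; exact: perm_big.
  + apply/card_eqPle; split; last first.
      apply: (card_le_inj (f := gen)) => // S T _ _; exact: gen_inj.
    apply: card_le_trans (card_seq_set Kinf).
    have /choice[f fP] : forall h, exists s, monomials G h -> h = mon s.
      move=> h; have [/monomials_range[s hs _]|nG] := pselect (monomials G h).
        by exists s.
      by exists [::].
    apply: (card_le_inj (f := f)) => // h h' /fP hE /fP h'E e.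
    by rewrite hE h'E e.
- move=> _ [S _ <-].
  have -> : G `\ gen S = gen @` [set T | T <> S].
    apply/seteqP; split=> [_ [[T _ <-] TS]|_ [T TS <-]].
      by exists T => // TS'; apply: TS; rewrite TS'.
    by split; [exists T|move=> /gen_inj].
  (* [indep S] would be a combination of monomials avoiding [S], so that the coefficient of [[:: S]]
     would be both 1 and 0. *)
  move=> /span_mon[n [c [s [/transfer_inj e sS _]]]].
  have h x : \sum_(j < n) c j * indep_mon (s j) x = 1 * indep_mon [:: S] x.
    by rewrite mul1r /indep_mon big_seq1 -/(indep_mon _ _) e.
  have := indep_mon_coef h; rewrite big_pred0 => [/eqP|j].
    by rewrite eq_sym oner_eq0.
  apply/negP => /perm_mem/(_ S); rewrite inE eqxx => Ss.
  by have := sS _ _ Ss.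
Qed.

End Transfer.

(** * Non-null pieces whose union has no measurable non-null subset *)

Section Partition.
Variables (R : realType) (K : Type) (lt : K -> K -> Prop).
Local Notation mu := (@lebesgue_measure R).

(** The pieces are encoded as the fibres of [l] inside [X], which makes them disjoint. *)
Definition nonnull_partition (X : set R) (l : R -> K) : Prop :=
  [/\ X `<=` `[0, 1]%classic, X #<= [set: K],
      forall k, ~ leb_null [set t | X t /\ l t = k] &
      forall Z, Z `<=` X -> leb_measurable_set Z -> leb_null Z].

Lemma countable_leb_null (A : set R) : countable A -> leb_null A.
Proof.
move=> cA; apply/negligibleP; last exact: countable_lebesgue_measure0.
exact: countable_measurable.
Qed.

Lemma nonN_infinite : card_is_nonN R K -> [set: nat] #<= [set: K].
Proof.
move=> [[A [_ [AK nA]]] _]; apply/infiniteP => fK; apply: nA.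
apply: countable_leb_null; apply: finite_set_countable.
by rewrite (eq_finite_set AK).
Qed.

Lemma partition_of_small : initial_ordinal lt -> card_is_nonN R K ->
  ~ ([set: R] #<= [set: K]) -> exists X l, nonnull_partition X l.
Proof.
move=> ordK nonK RK; have Kinf := nonN_infinite nonK.
have [[A [A01 [AK nA]]] _] := nonK.
have wf : well_founded lt by case: ordK => _ [_ [_ []]].
have [k0 _] := infinite_nonempty Kinf.
have [q qinj] := inj_of_card_leT k0 (card_square Kinf).
have AleK : A #<= [set: K] by move: AK; rewrite card_eq_le => /andP[].
have [al _ alinj] := inj_of_card_le k0 AleK.
(* Zero is removed to allow division. *)
pose A' := [set x | A x /\ 0 < x].
have nA' : ~ leb_null A'.
  move=> nA'; apply: nA; have n0 : leb_null [set (0 : R)] by exact: countable_leb_null.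
  apply: negligibleS (negligibleU nA' n0) => x Ax.
  have /andP[] := A01 _ Ax; rewrite le_eqVlt => /orP[/eqP <-|x0] _; first by right.
  by left.
(* The bounds keep [y] positive and [y * a] in [[0, 1]]; the second clause makes the multiples of
   [A'] disjoint. *)
pose P (k : K) (U : set (K * R)) (y : R) := 2^-1 <= y <= 1 /\
  forall j z a a', U (j, z) -> A' a -> A' a' -> y * a <> z * a'.
have [x xP] := wf_choice 0 P wf.
have {xP} [x01 xdis] : (forall k, 2^-1 <= x k <= 1) /\
    (forall j k a a', lt j k -> A' a -> A' a' -> x k * a <> x j * a').
  suff h k : P k [set (j, x j) | j in lt^~ k] (x k).
    split=> [k|j k a a' jk]; first by case: (h k).
    by case: (h k) => _; apply; exists j.
  (* Were no [y] admissible, each point of [[1/2, 1]] would be a quotient [x j * a' / a], and there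
     are at most [K] many of these. *)
  apply: xP; apply: contrapT => nP; apply: RK.
  have C0 : [set: R] #<= `[2^-1 : R, 1]%classic.
    apply: card_closed_pos; first exact: itv_closed.
      move=> y; rewrite /= !in_itv /= => /andP[y0 ->]; rewrite andbT.
      by apply: le_trans y0; rewrite invr_ge0.
    rewrite lebesgue_measure_itv /= lte_fin invf_lt1 ?ltr1n // -EFinB lte_fin subr_gt0.
    by rewrite invf_lt1 ?ltr1n.
  apply: card_le_trans C0 _.
  have /choice[f fP] : forall y, exists p : K * (R * R), 2^-1 <= y <= 1 ->
      [/\ A' p.2.1, A' p.2.2 & y * p.2.1 = x p.1 * p.2.2].
    move=> y; have [y01|ny] := boolP (2^-1 <= y <= 1); last by exists (k0, (0, 0)).
    apply: contrapT => h; apply: nP; exists y; split=> // j _ a a' [i _ [_ <-]] Aa Aa' e.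
    by apply: h; exists (i, (a, a')).
  apply: (card_le_inj (f := fun y => q ((f y).1, q (al (f y).2.1, al (f y).2.2)))) => //.
  move=> y z; rewrite /= !in_itv /= => /fP[[Ay y0] [Ay' _] ey] /fP[[Az _] [Az' _] ez].
  move=> /qinj[e1 /qinj[/(alinj _ _ Ay Az) e2 /(alinj _ _ Ay' Az') e3]].
  by apply: (mulIf (lt0r_neq0 y0)); rewrite ey e2 ez e1 e3.
pose X := [set t | exists k a, A' a /\ t = x k * a].
have /choice[f fP] : forall t, exists p : K * R, X t -> A' p.2 /\ t = x p.1 * p.2.
  move=> t; have [[k [a kaP]]|nX] := pselect (X t); first by exists (k, a).
  by exists (k0, 0).
have XK : X #<= [set: K].
  apply: (card_le_inj (f := fun t => q ((f t).1, al (f t).2))) => //.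
  move=> s t /fP[[As _] es] /fP[[At _] et] /qinj[e1 /(alinj _ _ As At) e2].
  by rewrite es et e1 e2.
exists X, (fun t => (f t).1); split=> //.
- move=> _ [k [a [[/A01/andP[a0 a1] _] ->]]]; rewrite /= in_itv /=.
  have /andP[x0 x1] := x01 k; have {}x0 : 0 <= x k by apply: le_trans x0; rewrite invr_ge0.
  by rewrite mulr_ge0 //= mulr_ile1.
- move=> k nk; apply: nA'.
  have xk : 0 < x k.
    by have /andP[+ _] := x01 k; apply: lt_le_trans; rewrite invr_gt0.
  apply: (leb_null_scale xk); apply: negligibleS nk => _ [a Aa <-].
  have Xt : X (x k * a) by exists k, a.
  split=> //; have [Af e] := fP _ Xt.
  have [_ [_ [tri _]]] := ordK.
  have [/xdis/(_ Aa Af)|[//|/xdis/(_ Af Aa)]] := tri (f (x k * a)).1 k; first by [].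
  by rewrite -e.
(* A closed set of positive measure inside [Z] would be too large for [X]. *)
- move=> Z ZX mZ; apply: contrapT => nZ; apply: RK.
  have Z01 : Z `<=` `[0, 1]%classic.
    move=> _ /ZX[k [a [[/A01/andP[a0 a1] _] ->]]]; rewrite /= in_itv /=.
    have /andP[x0 x1] := x01 k; have {}x0 : 0 <= x k by apply: le_trans x0; rewrite invr_ge0.
    by rewrite mulr_ge0 //= mulr_ile1.
  have [C [cC CZ C0]] := leb_measurable_closed_sub Z01 mZ nZ.
  have RC := card_closed_pos cC (subset_trans CZ Z01) C0.
  apply: card_le_trans RC (card_le_trans (subset_card_le _) XK).
  exact: subset_trans CZ ZX.
Qed.

(** Here [K] has the size of the line, so the closed sets of positive measure can be enumerated
    along [K]. *)
Lemma partition_of_large : initial_ordinal lt -> card_is_nonN R K ->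
  [set: R] #<= [set: K] -> exists X l, nonnull_partition X l.
Proof.
move=> ordK nonK RK; have Kinf := nonN_infinite nonK.
have [[A [A01 [AK nA]]] _] := nonK.
have KR : [set: K] #<= [set: R].
  apply: card_le_trans (card_leT A).
  by move: AK; rewrite card_eq_le => /andP[].
have [_ [_ [tri [wf small]]]] := ordK.
have [k0 _] := infinite_nonempty Kinf.
have [q qinj] := inj_of_card_leT k0 (card_square Kinf).
have [em eminj] := inj_of_card_leT k0 Kinf.
have [cc _ ccinj] := inj_of_card_le k0 (card_le_trans (card_closed_real R) RK).
pose oo (o : option K) := if o is Some k then q (em 0%N, k) else q (em 1%N, k0).
have ooinj : injective oo.
  by case=> [j|] [k|] //= /qinj[]; [move=> ->|move=> /eminj|move=> /eminj].
(* At stage [e C o] the recursion picks a point of [C]: one in the piece [k] if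
   [o = Some k], one in the complement of [X] if [o = None]. *)
pose e C o := q (cc C, oo o).
pose good (C : set R) := [/\ closed C, C `<=` `[0, 1]%classic & (0 < mu C)%E].
have einj C C' o o' : good C -> good C' -> e C o = e C' o' -> C = C' /\ o = o'.
  by move=> [cC _ _] [cC' _ _] /qinj[/(ccinj _ _ cC cC') -> /ooinj ->].
pose P (k : K) (U : set (K * R)) (y : R) :=
  (forall C o, good C -> k = e C o -> C y) /\ (forall j, ~ U (j, y)).
have [g gP] := wf_choice 0 P wf.
(* Fewer than [K] many points were picked before this stage, while [C] has as many points as the
   line. *)
have gC C o : good C -> P (e C o) [set (j, g j) | j in lt^~ (e C o)] (g (e C o)).
  move=> gdC; apply: gP; apply: contrapT => nP; apply: (small (e C o)).
  have RC : [set: R] #<= C by case: gdC => *; exact: card_closed_pos.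
  apply: card_le_trans KR (card_le_trans RC _).
  apply: card_le_trans (card_image_le g _); apply: subset_card_le => y Cy.
  apply: contrapT => ny; apply: nP; exists y; split=> [C' o' gdC'|j [i ik [_ iy]]].
    by move=> /(einj _ _ _ _ gdC gdC')[<-].
  by apply: ny; exists i.
have gin C o : good C -> C (g (e C o)).
  by move=> gdC; have [h _] := gC _ o gdC; exact: h gdC _.
have ginj C C' o o' : good C -> good C' -> g (e C o) = g (e C' o') -> o = o'.
  move=> gdC gdC' ge; apply: (proj2 (einj C C' o o' gdC gdC' _)).
  have [ee|[//|ee]] := tri (e C o) (e C' o').
    have [_ /(_ (e C o))[]] := gC _ o' gdC'.
    by exists (e C o) => //; rewrite ge.
  have [_ /(_ (e C' o'))[]] := gC _ o gdC.
  by exists (e C' o') => //; rewrite ge.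
pose X := [set t | exists C k, good C /\ t = g (e C (Some k))].
have X01 : X `<=` `[0, 1]%classic.
  by move=> _ [C [k [gdC ->]]]; have [_ + _] := gdC; apply; exact: gin.
have /choice[l lP] : forall t, exists l0, forall C k, good C -> t = g (e C (Some k)) -> k = l0.
  move=> t; have [[C [k [gdC ->]]]|nX] := pselect (X t).
    by exists k => C' k' gdC' /(ginj _ _ _ _ gdC gdC')[].
  by exists k0 => C k gdC tE; case: nX; exists C, k.
have closed_sub Z : Z `<=` `[0, 1]%classic -> leb_measurable_set Z -> ~ leb_null Z ->
    exists2 C, good C & C `<=` Z.
  move=> Z01 mZ nZ; have [C [cC CZ C0]] := leb_measurable_closed_sub Z01 mZ nZ.
  by exists C => //; split=> //; exact: subset_trans CZ Z01.
exists X, l; split=> //.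
- by apply: card_le_trans RK; exact: card_leT.
(* A piece meets every [good] set, including one that avoids a supposed null cover [N] of the
   piece. *)
- move=> k [N [mN N0 kN]].
  have [||nZ|C gdC CZ] := closed_sub (`[0, 1]%classic `\` N).
  + by move=> ? [].
  + exists (`[0, 1]%classic `\` N); first exact: measurableD.
    by exists set0; [exact: negligible_set0|rewrite setU0].
  + have : leb_null (`[0, 1]%classic : set R).
      have nN : leb_null N by exists N; split.
      apply: negligibleS (negligibleU nZ nN) => x x01.
      by have [Nx|nNx] := pselect (N x); [right|left].
    move=> /negligibleP h; have : mu `[0, 1]%classic = 0%E by exact: h.
    rewrite lebesgue_measure_itv /= lte_fin ltr01 -EFinB subr0 => -[] /eqP.
    by rewrite oner_eq0.
  + have [_ []] := CZ _ (gin C (Some k) gdC); apply: kN; split; first by exists C, k.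
    exact/esym/(lP _ C).
(* A [good] set inside [Z] contains a point picked with [None], which by [ginj] is not in [X]. *)
- move=> Z ZX mZ; apply: contrapT => nZ.
  have [C gdC CZ] := closed_sub Z (subset_trans ZX X01) mZ nZ.
  have [C' [k [gdC' /(ginj _ _ _ _ gdC gdC')]]] := ZX _ (CZ _ (gin C None gdC)).
  by [].
Qed.

Lemma partition_exists : initial_ordinal lt -> card_is_nonN R K ->
  exists X l, nonnull_partition X l.
Proof.
move=> ordK nonK; have [RK|RK] := pselect ([set: R] #<= [set: K]).
  exact: partition_of_large.
exact: partition_of_small.
Qed.

Lemma leb_measurable_fun_null (f : R -> R) :
  leb_null [set t | f t <> 0] -> leb_measurable_fun f.
Proof.
move=> [N [mN N0 fN]] B _; have [B0|nB0] := pselect (B 0); last first.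
  exists set0 => //; exists (f @^-1` B); last by rewrite set0U.
  exists N; split=> // t /= Bft; apply: fN => /= ft0; apply: nB0; by rewrite -ft0.
exists (~` N); first exact: measurableC.
exists (f @^-1` B `&` N); first by exists N; split=> // t [].
apply/seteqP; split=> t; last by have [Nt|nNt] := pselect (N t); [right|left].
move=> [nNt|[]//]; rewrite /preimage /=.
have -> // : f t = 0 by apply: contrapT => /fN.
Qed.

End Partition.

(** * Null initial segments of [X] and their non-measurable limit *)

Theorem mainTheorem16 (R : realType) (K : Type) (lt : K -> K -> Prop) :
  initial_ordinal lt -> card_is_nonN R K ->
  algebrable (@AN R K lt) (set K).
Proof.
move=> ordK nonK; have Kinf := nonN_infinite nonK.
have [X [l [X01 XK nl Xnull]]] := partition_exists ordK nonK.
have [ltxx [_ [tri [_ small]]]] := ordK.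
have [k0 _] := infinite_nonempty Kinf.
have [b _ binj] := inj_of_card_le k0 XK.
have [em eminj] := inj_of_card_leT k0 Kinf.
have [q qinj] := inj_of_card_leT k0 (card_square Kinf).
have [c cinj] := inj_of_card_leT k0 (card_list Kinf).
(* The pieces are labelled by [K]; [f] and its left inverse [inv] turn these labels into indices. *)
pose f (i : seq K * nat * nat) := q (q (c i.1.1, em i.1.2), em i.2).
have finj : injective f.
  by move=> [[F m] n] [[F' m'] n'] /qinj[/qinj[/cinj -> /eminj ->] /eminj ->].
have /choice[inv invP] : forall k, exists i, forall j, f j = k -> j = i.
  move=> k; have [[i <-]|nf] := pselect (exists i, f i = k).
    by exists i => j /finj.
  by exists ([::], 0%N, 0%N) => j fj; case: nf; exists j.
have fK i : inv (f i) = i by apply/esym/invP.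
pose D a t := `[< X t /\ lt (b t) a >].
apply: (@algebrable_transfer R K D (inv \o l)) => // [i|u [i ui]].
  (* A non-null piece has two points, and the one with smaller [b] lies in the initial segment cut
     off by the other. *)
  suff [s [t [[Xs ls] [Xt lt_] st]]] : exists s t,
      [/\ X s /\ l s = f i, X t /\ l t = f i & s <> t].
    have [h|[/(binj _ _ Xs Xt)//|h]] := tri (b s) (b t).
      by exists (b t), s; split; [exact/asboolP|rewrite /= ls fK].
    by exists (b s), t; split; [exact/asboolP|rewrite /= lt_ fK].
  apply: contrapT => h; apply: (nl (f i)); apply: countable_leb_null.
  apply: (card_le_inj (f := fun=> 0%N)) => // s t sP tP _.
  by apply: contrapT => st; apply: h; exists s, t.
split=> [a|].
  apply: leb_measurable_fun_null.
  (* Through [b] this set injects into the predecessors of [a], so it is smaller than [K] and hence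
     null. *)
  suff D0 : leb_null [set t | X t /\ lt (b t) a].
    by apply: negligibleS D0 => t /=; rewrite /transfer; case: ifP => // /asboolP.
  apply: nonK.2 => [t [/X01]|Ka]; first by rewrite /= in_itv.
  apply: (small a); apply: card_le_trans Ka _.
  apply: (card_le_inj (f := b)) => [t [_]//|s t [Xs _] [Xt _]]; exact: binj.
exists (fun t => if `[< X t >] then u (inv (l t)) else 0); split.
  (* The non-zero set of the limit lies in [X] and contains the piece [f i]; were it measurable,
     that piece would be null. *)
  move=> /(_ (~` [set 0]) (measurableC (measurable_set1 _))) mZ.
  apply: (nl (f i)); apply: negligibleS (Xnull _ _ mZ).
    move=> t [Xt lt_] /=; rewrite (asboolT Xt) lt_ fK; exact: ui.
  by move=> t /=; case: ifP => [/asboolP//|_ /(_ erefl)].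
have -> : [set t | ~ kseq_cvg lt (fun a => transfer D (inv \o l) u a t)
    (if `[< X t >] then u (inv (l t)) else 0)] = set0; last exact: negligible_set0.
apply/seteqP; split=> // t; apply => U /nbhs_singleton Ut.
(* Past [b t] the sequence at [t] is constant, so convergence holds everywhere. *)
exists (b t) => a bta; move: Ut; rewrite /transfer /D.
have [Xt|nXt] := pselect (X t).
  by rewrite (asboolT Xt) (asboolT (conj Xt bta)).
by rewrite (asboolF nXt) asboolF // => -[].
Qed.
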